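(* Let $S=\mathcal{S}(Y;S_\alpha;\phi_{\alpha,\beta})$ be a strong semilattice of semigroups, where each $S_\alpha$ is left ample and the connecting morphisms $\phi_{\alpha,\beta}$ are $(2,1)$-morphisms. (i) The semigroup $S$ is left ample, and for any $a,b\in S$, $a\,\mathcal{R}^*\,b$ in $S$ if and only if $a,b\in S_\alpha$ for some $\alpha\in Y$ and $a\,\mathcal{R}^*\,b$ in $S_\alpha$. (ii) If each $S_\alpha$ has (LC), then $S$ has (LC) if and only if every $\phi_{\alpha,\beta}$, $\alpha\geq\beta$, is (LC)-preserving.
   Context: For a semigroup $S$, $a\,\mathcal{R}^*\,b$ means that for all $x,y\in S^1$, $xa=ya\Leftrightarrow xb=yb$. A semigroup $S$ is left ample if $E(S)$ is a semilattice, every $\mathcal{R}^*$-class contains a (necessarily unique) idempotent, the one in the class of $a$ being denoted $a^+$, and $xy^+=(xy^+)^+x$ for all $x,y\in S$. A $(2,1)$-morphism between left ample semigroups is a semigroup morphism preserving $^+$. A semigroup $S$ has (LC) if for any $a,b\in S$ there is $c\in S$ with $Sa\cap Sb=Sc$. A $(2,1)$-morphism $\phi:S\to T$ between left ample semigroups with (LC) is (LC)-preserving if for any $b,c,w\in S$ with $Sb\cap Sc=Sw$ we have $T(b\phi)\cap T(c\phi)=T(w\phi)$. Strong semilattice: $S=\mathcal{S}(Y;S_\alpha;\phi_{\alpha,\beta})$ means $Y$ is a semilattice, $S$ is the disjoint union of semigroups $S_\alpha$ $(\alpha\in Y)$, there are morphisms $\phi_{\alpha,\beta}:S_\alpha\to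 S_\beta$ for $\alpha\geq\beta$ (maps written on the right) with $\phi_{\alpha,\alpha}$ the identity and $\phi_{\alpha,\beta}\phi_{\beta,\gamma}=\phi_{\alpha,\gamma}$ for $\alpha\geq\beta\geq\gamma$, and the product of $a\in S_\alpha$, $b\in S_\beta$ is $ab=(a\phi_{\alpha,\alpha\beta})(b\phi_{\beta,\alpha\beta})$ computed in $S_{\alpha\beta}$. *)

(* Defs.v *)
From HB Require Import structures.
From mathcomp Require Import all_boot all_order.
From mathcomp Require Import boolp classical_sets.

Set Implicit Arguments.
Unset Strict Implicit.
Unset Printing Implicit Defensive.

Import Order.TTheory.

Local Open Scope group_scope.
Local Open Scope classical_set_scope.

Section LeftAmple.
Variable S : semigroupType.
Implicit Types a b e : S.

Definition is_monoid := exists u : S, left_id u *%g /\ right_id u *%g.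

(* S^1 is S with an identity adjoined if S has none: [Some s] stands for s, and
   [None] for the adjoined identity, present only when S is not a monoid. *)
Definition S1 : set (option S) :=
  [set x | if x is Some _ then True else ~ is_monoid].

Definition S1_mul (x : option S) a : S := if x is Some s then s * a else a.

Definition Rstar a b := forall x y, S1 x -> S1 y ->
  (S1_mul x a = S1_mul y a <-> S1_mul x b = S1_mul y b).

Definition idempotent_elt e := e * e = e.

Definition idempotents_semilattice := forall e f : S,
  idempotent_elt e -> idempotent_elt f ->
  idempotent_elt (e * f) /\ e * f = f * e.

(* The idempotent a^+ in the R*-class of a; a junk value if there is none. *)
Definition ample_plus a : S := xget a [set e | idempotent_elt e /\ Rstar a e].

Definition left_ample :=
  [/\ idempotents_semilattice,
      forall a, exists e, idempotent_elt e /\ Rstar a e &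
      forall x y : S,
        x * ample_plus y = ample_plus (x * ample_plus y) * x].

(* Sa, which need not contain a *)
Definition principal a : set S := [set x * a | x in [set: S]].

Definition has_LC := forall a b, exists c,
  principal a `&` principal b = principal c.

End LeftAmple.

Section Morphisms.
Variables S T : semigroupType.

Definition morphism21 (f : S -> T) :=
  {morph f : x y / x * y} /\ {morph f : x / ample_plus x}.

Definition LC_preserving (f : S -> T) := forall b c w : S,
  principal b `&` principal c = principal w ->
  principal (f b) `&` principal (f c) = principal (f w).

End Morphisms.

Local Open Scope order_scope.

Record strongSemilattice d (Y : meetSemilatticeType d) := StrongSemilattice {
  component :> Y -> semigroupType;
  conn : forall alpha beta : Y, beta <= alpha ->
    component alpha -> component beta;
  connM : forall (alpha beta : Y) (le_ba : beta <= alpha),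
    {morph conn le_ba : x y / x * y};
  conn_id : forall (alpha : Y) (le_aa : alpha <= alpha) x, conn le_aa x = x;
  conn_comp : forall (alpha beta gamma : Y) (le_ba : beta <= alpha)
    (le_cb : gamma <= beta) (le_ca : gamma <= alpha) x,
    conn le_cb (conn le_ba x) = conn le_ca x }.

Arguments conn {d Y} M {alpha beta} le_ba _ : rename.

Section StrongSemilatticeSemigroup.
Variables (d : Order.disp_t) (Y : meetSemilatticeType d).
Variable M : strongSemilattice Y.

Definition union_of := {alpha : Y & M alpha}.

HB.instance Definition _ := Choice.copy union_of {alpha : Y & M alpha}.

Definition union_mul (a b : union_of) : union_of :=
  Tagged (component M)
    (conn M (leIl (tag a) (tag b)) (tagged a) *
     conn M (leIr (tag b) (tag a)) (tagged b)).

Lemma Tagged_conn alpha beta (le_ba : beta <= alpha) (x : M alpha) :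
  alpha = beta ->
  Tagged (component M) x = Tagged (component M) (conn M le_ba x) :> union_of.
Proof. by move=> eq_ab; case: _ / eq_ab le_ba => le_aa; rewrite conn_id. Qed.

Lemma union_mulA : associative union_mul.
Proof.
move=> [alpha a] [beta b] [gamma c]; rewrite /union_mul /=.
have le_ab : (alpha `&` beta) `&` gamma <= alpha `&` (beta `&` gamma).
  by rewrite meetA.
rewrite (Tagged_conn le_ab) ?meetA // !connM mulgA.
congr (Tagged (component M) (_ * _ * _)%g).
- have le_a : (alpha `&` beta) `&` gamma <= alpha.
    exact: le_trans (leIl _ _) (leIl _ _).
  by rewrite (conn_comp _ _ le_a) (conn_comp _ _ le_a).
- have le_b : (alpha `&` beta) `&` gamma <= beta.
    exact: le_trans (leIl _ _) (leIr _ _).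
  rewrite (conn_comp (leIr _ _) (leIl _ _) le_b).
  have le_b' : alpha `&` (beta `&` gamma) <= beta.
    exact: le_trans (leIr _ _) (leIl _ _).
  by rewrite (conn_comp (leIl _ _) (leIr _ _) le_b') (conn_comp le_b' le_ab le_b).
- have le_c' : alpha `&` (beta `&` gamma) <= gamma.
    exact: le_trans (leIr _ _) (leIr _ _).
  rewrite (conn_comp (leIr _ _) (leIr _ _) le_c').
  exact: conn_comp.
Qed.

HB.instance Definition _ := isSemigroup.Build union_of union_mulA.

End StrongSemilatticeSemigroup.

(* Main.v *)
Require Import Defs.
From HB Require Import structures.
From mathcomp Require Import all_boot all_order.
From mathcomp Require Import boolp classical_sets.

Local Open Scope order_scope.

(** Everything rests on two descriptions of the strong semilattice [S] of the
    [S_alpha] in terms of its components.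

    The first concerns left multiplication. Every element of [S^1], restricted
    to [S_alpha], is a connecting morphism [S_alpha -> S_gamma] followed by left
    multiplication by an element of [S_gamma^1] ([S1_mul_Tagged]). An equation
    [xa = ya] in [S] thus says that [x] and [y] lead to the same component, which
    does not depend on [a], and that [x'(a phi) = y'(a phi)] there. In left ample semigroups [a R* b] amounts to [a^+ = b^+], so
    (2,1)-morphisms preserve R*; hence elements of [S_alpha] that are R*-related
    there stay so in [S] ([Rstar_Tagged]). In particular the idempotent [a^+] of
    [S_alpha] is also the idempotent of the R*-class of [a] in [S], and the
    ample identity in [S] is the ample identity of the component of the product.
    Conversely, if [a R* b] in [S] then [a^+ = b^+] in [S], which forces [a] and
    [b] into the same component and gives [a R* b] there.

    The second concerns principal left ideals: [Sa], for [a] in [S_alpha], meets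
    [S_gamma] in [S_gamma (a phi)] if [gamma <= alpha], and is disjoint from it
    otherwise ([principal_Tagged]). So [Sa] and [Sb] intersect, in each component
    below [alpha] and [beta], in [S_gamma (a phi)] and [S_gamma (b phi)]
    intersected. If the connecting morphisms are (LC)-preserving, a generator of
    the intersection in [S_(alpha beta)] therefore generates all of [Sa] and [Sb]
    intersected ([union_LC_of_LC_preserving]). Conversely, let [b] and [c] lie
    in [S_alpha], let [w] generate the intersection of [S_alpha b] and
    [S_alpha c], and let [v] generate that of [Sb] and [Sc]. An element of a left
    ample semigroup lies in the left ideal it generates; so [v] lies in [Sb],
    hence in a component below [alpha], and [w] lies in [Sv], so that this
    component is [S_alpha]. There each of [v] and [w] lies in the left ideal
    generated by the other, and the same holds of [v phi] and [w phi]. As the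
    left ideal of [v phi] is the required intersection, so is that of [w phi]
    ([LC_preserving_of_union_LC]). *)

Set Implicit Arguments.
Unset Strict Implicit.
Unset Printing Implicit Defensive.

Import Order.TTheory.

(** * The relation R* and the operation ^+ *)

Section RstarTheory.
Local Open Scope group_scope.
Local Open Scope classical_set_scope.
Variable S : semigroupType.
Implicit Types a b e f : S.

(** When [S] has an identity, it acts on the left as the adjoined one would, so
    the side conditions on membership in [S^1] can be dropped. *)
Lemma RstarP a b : Rstar a b <->
  forall x y : option S,
    S1_mul x a = S1_mul y a <-> S1_mul x b = S1_mul y b.
Proof.
split=> [Rab|Rab x y _ _]; last exact: Rab.
have in_S1 x : exists2 x', S1 x' & forall c : S, S1_mul x' c = S1_mul x c.
  case: x => [s|]; first by exists (Some s).
  have [[u [u1 u2]]|nmon] := pselect (is_monoid S); last by exists None.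
  by exists (Some u) => // c /=; rewrite u1.
move=> x y; have [x' S1x Ex] := in_S1 x; have [y' S1y Ey] := in_S1 y.
by rewrite -!Ex -!Ey; exact: Rab.
Qed.

Lemma Rstar_sym a b : Rstar a b -> Rstar b a.
Proof. by move=> Rab x y S1x S1y; split=> /(Rab x y S1x S1y). Qed.

Lemma Rstar_trans a b c : Rstar a b -> Rstar b c -> Rstar a c.
Proof.
move=> Rab Rbc x y S1x S1y; split.
  by move=> /(Rab x y S1x S1y) /(Rbc x y S1x S1y).
by move=> /(Rbc x y S1x S1y) /(Rab x y S1x S1y).
Qed.

(** The equation [e * e = 1 * e] transfers along R*. *)
Lemma Rstar_idempotent_mul e a : idempotent_elt e -> Rstar a e -> e * a = a.
Proof. by move=> idem_e /RstarP/(_ (Some e) None) [_]; apply. Qed.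

Lemma Rstar_idempotent_eq e f : idempotents_semilattice S ->
  idempotent_elt e -> idempotent_elt f -> Rstar e f -> e = f.
Proof.
move=> semiS idem_e idem_f Ref.
rewrite -[LHS](Rstar_idempotent_mul idem_f Ref).
rewrite -[RHS](Rstar_idempotent_mul idem_e (Rstar_sym Ref)).
by have [_ ->] := semiS e f idem_e idem_f.
Qed.

Lemma ample_plus_eq a e : idempotents_semilattice S ->
  idempotent_elt e -> Rstar a e -> ample_plus a = e.
Proof.
move=> semiS idem_e Rae.
have [idem_p Rap] : [set e | idempotent_elt e /\ Rstar a e] (ample_plus a).
  by apply: xgetPex; exists e.
apply: Rstar_idempotent_eq => //.
exact: Rstar_trans (Rstar_sym Rap) Rae.
Qed.

Hypothesis ampleS : left_ample S.

Lemma left_ample_semilattice : idempotents_semilattice S.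
Proof. by case: ampleS. Qed.

Lemma ample_plusP a : idempotent_elt (ample_plus a) /\ Rstar a (ample_plus a).
Proof.
have [semiS exS _] := ampleS; have [e [idem_e Rae]] := exS a.
by rewrite (ample_plus_eq semiS idem_e Rae).
Qed.

Lemma ample_plus_mul a : ample_plus a * a = a.
Proof. by have [idem_p Rap] := ample_plusP a; apply: Rstar_idempotent_mul. Qed.

Lemma Rstar_plusE a b : Rstar a b <-> ample_plus a = ample_plus b.
Proof.
have [idem_a Ra] := ample_plusP a; have [idem_b Rb] := ample_plusP b.
split=> [Rab|eq_ab]; last first.
  by apply: Rstar_trans Ra _; rewrite eq_ab; exact: Rstar_sym.
by apply: (ample_plus_eq left_ample_semilattice idem_b (Rstar_trans Rab Rb)).
Qed.

Lemma principal_refl a : principal a a.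
Proof. by exists (ample_plus a) => //; exact: ample_plus_mul. Qed.

End RstarTheory.

Lemma morphism21_Rstar (S T : semigroupType) (f : S -> T) (a b : S) :
  left_ample S -> left_ample T -> morphism21 f ->
  Rstar a b -> Rstar (f a) (f b).
Proof.
move=> ampleS ampleT [_ f_plus] /(Rstar_plusE ampleS) eq_ab.
by apply/(Rstar_plusE ampleT); rewrite -!f_plus eq_ab.
Qed.

Section PrincipalLeftIdeals.
Local Open Scope group_scope.
Local Open Scope classical_set_scope.

Lemma principal_sub (S : semigroupType) (a b : S) :
  principal b a -> principal a `<=` principal b.
Proof. by case=> x _ <- _ [y _ <-]; exists (y * x); rewrite ?mulgA. Qed.

Lemma principal_morph (S T : semigroupType) (f : S -> T) (a b : S) :
  {morph f : x y / x * y} -> principal b a -> principal (f b) (f a).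
Proof. by move=> fM [x _ <-]; exists (f x); rewrite // fM. Qed.

End PrincipalLeftIdeals.

(** * Strong semilattices in terms of their components *)

Section StrongSemilatticeTheory.
Variables (d : Order.disp_t) (Y : meetSemilatticeType d).
Variable M : strongSemilattice Y.

Local Notation "<< x >>" := (Tagged (component M) x : union_of M).

Lemma Tagged_component_inj alpha (x y : M alpha) : <<x>> = <<y>> -> x = y.
Proof. by move/eqP; rewrite eq_Tagged => /eqP. Qed.

(** The index [gamma] is only required to be provably equal to the meet: the
    components at [alpha `&` beta], at [beta `&` alpha] and, when
    [alpha <= beta], at [alpha] are different types, and a product is to be
    computed in whichever of them the context calls for. *)
Lemma union_mulE alpha beta gamma (le_a : gamma <= alpha)
    (le_b : gamma <= beta) (a : M alpha) (b : M beta) :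
  gamma = alpha `&` beta ->
  (<<a>> * <<b>> = <<conn M le_a a * conn M le_b b>>)%g.
Proof.
move=> eq_g; subst gamma; rewrite [LHS]/(union_mul _ _) /union_mul /=.
by rewrite (bool_irrelevance (leIl _ _) le_a) (bool_irrelevance (leIr _ _) le_b).
Qed.

Lemma union_mul_same alpha (a b : M alpha) : (<<a>> * <<b>> = <<a * b>>)%g.
Proof. by rewrite (union_mulE (lexx alpha) (lexx alpha)) ?meetxx ?conn_id. Qed.

(** The adjoined identity acts on the component [alpha] as the adjoined identity
    of that component. *)
Lemma S1_mul_Tagged alpha (x : option (union_of M)) :
  exists gamma (le_ga : gamma <= alpha) (x' : option (M gamma)),
  forall a : M alpha, S1_mul x <<a>> = <<S1_mul x' (conn M le_ga a)>>.
Proof.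
case: x => [[beta x]|].
  exists (beta `&` alpha), (leIr _ _), (Some (conn M (leIl _ _) x)) => a /=.
  exact: union_mulE.
by exists alpha, (lexx alpha), None => a /=; rewrite conn_id.
Qed.

Lemma idempotent_Tagged alpha (e : M alpha) :
  idempotent_elt <<e>> <-> idempotent_elt e.
Proof.
rewrite /idempotent_elt union_mul_same.
by split=> [/Tagged_component_inj|->].
Qed.

Hypothesis ampleM : forall alpha : Y, left_ample (M alpha).
Hypothesis conn21 : forall (alpha beta : Y) (le_ba : beta <= alpha),
  morphism21 (conn M le_ba).

Lemma Rstar_Tagged alpha (a b : M alpha) : Rstar a b -> Rstar <<a>> <<b>>.
Proof.
suff half (a1 b1 : M alpha) x y : Rstar a1 b1 ->
    S1_mul x <<a1>> = S1_mul y <<a1>> -> S1_mul x <<b1>> = S1_mul y <<b1>>.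
  move=> Rab; apply/RstarP => x y; split; first exact: half.
  exact/half/Rstar_sym.
move=> Rab; have [gamma [le_g [x' Ex]]] := S1_mul_Tagged alpha x.
have [gamma' [le_g' [y' Ey]]] := S1_mul_Tagged alpha y.
rewrite !Ex !Ey => eq_xy.
have eq_g : gamma = gamma' by move/(congr1 (@tag _ _)): eq_xy.
subst gamma'; rewrite -(bool_irrelevance le_g le_g') in eq_xy *.
have /RstarP Rg := morphism21_Rstar (ampleM _) (ampleM _) (conn21 le_g) Rab.
by congr (<<_>>); apply/Rg/Tagged_component_inj.
Qed.

Lemma union_idempotents_semilattice : idempotents_semilattice (union_of M).
Proof.
move=> [alpha e] [beta f] /idempotent_Tagged idem_e /idempotent_Tagged idem_f.
have conn_idem gamma delta (le_dg : delta <= gamma) (g : M gamma) :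
    idempotent_elt g -> idempotent_elt (conn M le_dg g).
  by rewrite /idempotent_elt -connM => ->.
rewrite (union_mulE (leIl alpha beta) (leIr beta alpha)) //.
rewrite (union_mulE (leIr beta alpha) (leIl alpha beta)) 1?meetC //.
have [idem_ef eq_ef] := left_ample_semilattice (ampleM (alpha `&` beta))
  (conn_idem _ _ (leIl _ _) _ idem_e) (conn_idem _ _ (leIr _ _) _ idem_f).
by split; [exact/idempotent_Tagged | rewrite eq_ef].
Qed.

Lemma ample_plus_Tagged alpha (a : M alpha) :
  ample_plus <<a>> = <<ample_plus a>>.
Proof.
have [idem_p Rap] := ample_plusP (ampleM alpha) a.
apply: (ample_plus_eq union_idempotents_semilattice).
  exact/idempotent_Tagged.
exact: Rstar_Tagged.
Qed.

Lemma union_left_ample : left_ample (union_of M).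
Proof.
split; first exact: union_idempotents_semilattice.
  move=> [alpha a]; have [idem_p Rap] := ample_plusP (ampleM alpha) a.
  exists <<ample_plus a>>; split; first exact/idempotent_Tagged.
  exact: Rstar_Tagged.
move=> [alpha x] [beta y]; rewrite ample_plus_Tagged.
rewrite (union_mulE (leIl alpha beta) (leIr beta alpha)) // ample_plus_Tagged.
rewrite (union_mulE (lexx _) (leIl alpha beta)); last first.
  exact/esym/meet_idPl/leIl.
rewrite conn_id; have [_ ->] := conn21 (leIr beta alpha).
by have [_ _ <-] := ampleM (alpha `&` beta).
Qed.

Lemma union_RstarP (a b : union_of M) : Rstar a b <->
  exists (alpha : Y) (a' b' : M alpha),
    [/\ a = <<a'>>, b = <<b'>> & Rstar a' b'].
Proof.
split=> [/(Rstar_plusE union_left_ample)|]; last first.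
  by case=> alpha [a' [b' [-> -> Rab]]]; exact: Rstar_Tagged.
case: a b => [alpha a] [beta b]; rewrite !ample_plus_Tagged => eq_ab.
have eq_t : alpha = beta by move/(congr1 (@tag _ _)): eq_ab.
subst beta; exists alpha, a, b; split=> //.
exact/(Rstar_plusE (ampleM alpha))/Tagged_component_inj.
Qed.

(** For [gamma <= alpha] the multipliers can be taken in the component of [z]:
    [x * a] only depends on the image of [x] there. *)
Lemma principal_Tagged alpha gamma (a : M alpha) (z : M gamma) :
  principal <<a>> <<z>> <->
  exists le_ga : gamma <= alpha, principal (conn M le_ga a) z.
Proof.
split=> [[[beta x] _]|[le_ga [x _ <-]]]; last first.
  exists <<x>> => //; rewrite (union_mulE (lexx gamma) le_ga) ?conn_id //.
  by apply/esym/meet_idPl.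
rewrite (union_mulE (leIl beta alpha) (leIr alpha beta)) // => eq_z.
have eq_g : beta `&` alpha = gamma by move/(congr1 (@tag _ _)): eq_z.
subst gamma; exists (leIr _ _); exists (conn M (leIl _ _) x) => //.
exact: Tagged_component_inj.
Qed.

Lemma principal_Tagged_le alpha gamma (le_ga : gamma <= alpha)
    (a : M alpha) (z : M gamma) :
  principal <<a>> <<z>> <-> principal (conn M le_ga a) z.
Proof.
rewrite principal_Tagged; split=> [[le_ga']|]; last by exists le_ga.
by rewrite (bool_irrelevance le_ga' le_ga).
Qed.

Lemma union_LC_of_LC_preserving :
  (forall alpha : Y, has_LC (M alpha)) ->
  (forall (alpha beta : Y) (le_ba : beta <= alpha),
     LC_preserving (conn M le_ba)) ->
  has_LC (union_of M).
Proof.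
move=> LCM LCconn [alpha a] [beta b].
have [c Ec] := LCM _ (conn M (leIl alpha beta) a) (conn M (leIr beta alpha) b).
have Ec_below gamma (le_g : gamma <= alpha `&` beta)
    (le_ga : gamma <= alpha) (le_gb : gamma <= beta) :
    (principal (conn M le_ga a) `&` principal (conn M le_gb b))%classic =
    principal (conn M le_g c).
  by rewrite -(LCconn _ _ le_g _ _ _ Ec) (conn_comp _ _ le_ga) (conn_comp _ _ le_gb).
exists <<c>>; apply/seteqP; split=> [[gamma z]|[gamma z]] /=.
  move=> [/principal_Tagged [le_ga za] /principal_Tagged [le_gb zb]].
  have le_g : gamma <= alpha `&` beta by rewrite lexI le_ga.
  by apply/(principal_Tagged_le le_g); rewrite -(Ec_below _ _ le_ga le_gb).
move=> /principal_Tagged [le_g].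
have [le_ga le_gb] : gamma <= alpha /\ gamma <= beta.
  by apply/andP; rewrite -lexI.
rewrite -(Ec_below _ _ le_ga le_gb) => -[za zb].
by split; [apply/(principal_Tagged_le le_ga) | apply/(principal_Tagged_le le_gb)].
Qed.

Lemma LC_preserving_of_union_LC : has_LC (union_of M) ->
  forall (alpha beta : Y) (le_ba : beta <= alpha),
    LC_preserving (conn M le_ba).
Proof.
move=> LCS alpha beta le_ba b c w Ew.
have [[delta v] Ev] := LCS <<b>> <<c>>.
have [vb vc] : (principal <<b>> `&` principal <<c>>)%classic <<v>>.
  by rewrite Ev; exact: principal_refl union_left_ample _.
have [wb wc] : (principal b `&` principal c)%classic w.
  by rewrite Ew; exact: principal_refl.
have vw : principal <<v>> <<w>>.
  by rewrite -Ev; split; apply/(principal_Tagged_le (lexx alpha)); rewrite conn_id.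
have eq_da : delta = alpha.
  have [le_da _] := (principal_Tagged _ _).1 vb.
  have [le_ad _] := (principal_Tagged _ _).1 vw.
  by apply/eqP; rewrite eq_le le_da.
subst delta; move: vb vc vw.
move=> /(principal_Tagged_le (lexx alpha)) + /(principal_Tagged_le (lexx alpha)) +
  /(principal_Tagged_le (lexx alpha)).
rewrite !conn_id => vb vc vw.
have wv : principal w v by rewrite -Ew.
transitivity (principal (conn M le_ba v)).
  apply/seteqP; split=> z.
    move=> [/(principal_Tagged_le le_ba) zb /(principal_Tagged_le le_ba) zc].
    by apply/(principal_Tagged_le le_ba); rewrite -Ev.
  move=> /(principal_Tagged_le le_ba); rewrite -Ev => -[zb zc].
  by split; apply/(principal_Tagged_le le_ba).
by apply/seteqP; split; apply/principal_sub/(principal_morph (connM le_ba)).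
Qed.

End StrongSemilatticeTheory.

Theorem proposition4p2 (d : Order.disp_t) (Y : meetSemilatticeType d)
    (M : strongSemilattice Y)
    (ampleM : forall alpha : Y, left_ample (M alpha))
    (conn21 : forall (alpha beta : Y) (le_ba : beta <= alpha),
      morphism21 (conn M le_ba)) :
  (left_ample (union_of M) /\
   forall a b : union_of M,
     Rstar a b <->
     exists (alpha : Y) (a' b' : M alpha),
       [/\ a = Tagged (component M) a', b = Tagged (component M) b'
         & Rstar a' b']) /\
  ((forall alpha : Y, has_LC (M alpha)) ->
   (has_LC (union_of M) <->
    forall (alpha beta : Y) (le_ba : beta <= alpha),
      LC_preserving (conn M le_ba))).
Proof.
split; first by split; [exact: union_left_ample | exact: union_RstarP].
move=> LCM; split; first exact: LC_preserving_of_union_LC.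
exact: union_LC_of_LC_preserving.
Qed.
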